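(* Let $A$ be an $n$-rigid group with the principal series $A = A_1 > A_2 > \cdots > A_n > A_{n+1} = 1$, and let $G$ be a group containing $A$ as a subgroup. Suppose $\Phi$ is a set of $A$-epimorphisms from $G$ onto $A$ that $A$-discriminates $G$. Then: 1) $G$ is an $n$-rigid group; 2) if $G = G_1 > G_2 > \cdots > G_n > G_{n+1} = 1$ is the principal series of $G$, then $G_i\varphi = A_i$ for every $\varphi\in\Phi$ and $i=1,\ldots,n+1$; 3) the group $A/A_i$ discriminates the group $G/G_i$, $i=1,\ldots,n+1$, by the set of epimorphisms induced from $\Phi$.
   Context: A right module $T$ over a ring $R$ has no torsion if $xr=0$ with $x\in T$, $r\in R$ implies $x=0$ or $r=0$. A principal series of a group $G$ is a series of normal subgroups of $G$, $G = G_1 > G_2 > \cdots > G_n > G_{n+1} = 1$, such that each factor $G_i/G_{i+1}$ is abelian and has no torsion as a right $\mathbb{Z}[G/G_i]$-module (action induced by conjugation), $i=1,\ldots,n$. A group with a principal series is called rigid; the series is unique and its length $n$ is the solvability class of $G$. A rigid group of solvability class $n$ is called $n$-rigid. For a group $G$ containing $A$, an $A$-epimorphism $\varphi:G\to A$ is an epimorphism with $a\varphi=a$ for all $a\in A$ (maps are written on the right). A set $\Phi$ of homomorphisms from $G$ to $A$ discriminates $G$ (by $A$) if for every finite subset $K\subseteq G$ some $\varphi\in\Phi$ is injective on $K$; it $A$-discriminates $G$ if in addition all $\varphi \in \Phi$ are $A$-homomorphisms (identity on $A$). Given $G_i\varphi= A_i$, the epimorphism $G/G_i\to A/A_i$ induced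 by $\varphi$ is $gG_i\mapsto (g\varphi)A_i$. *)

(* Defs.v *)
From HB Require Import structures.
From mathcomp Require Import all_boot all_algebra.
From mathcomp Require Import finmap monalg.
From mathcomp Require Import boolp classical_sets functions cardinality.

Set Implicit Arguments.
Unset Strict Implicit.
Unset Printing Implicit Defensive.

Import GRing.Theory.

Local Open Scope classical_set_scope.
Local Open Scope group_scope.
Local Open Scope quotient_scope.

Notation "{ 'ghom' G -> H }" := (UMagmaMorphism.type G%type H%type)
  (at level 0, G at level 98, H at level 99, format "{ 'ghom'  G  ->  H }")
  : type_scope.

Section Subgroups.
Variable G : groupType.
Implicit Types (H K : set G) (x y g : G).

Definition is_subgroup H := H 1 /\ forall x y, H x -> H y -> H (x / y).

Record nsubgroup := NSubgroup {
  nset :> set G;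
  nset_subgroup : is_subgroup nset;
  nset_conj : forall x g, nset x -> nset (x ^ g) }.

Definition commutator_subgroup H : set G :=
  smallest is_subgroup [set [~ x, y] | x in H & y in H].

Definition derived k : set G := iter k commutator_subgroup [set: G].

Definition solvability_class k :=
  derived k = [set 1] /\ forall j, (j < k)%N -> derived j <> [set 1].

Variable N : nsubgroup.

Lemma nset1 : nset N 1. Proof. exact: (nset_subgroup N).1. Qed.

Lemma nsetF x y : nset N x -> nset N y -> nset N (x / y).
Proof. exact: (nset_subgroup N).2. Qed.

Lemma nsetV x : nset N x -> nset N x^-1.
Proof. by move=> Nx; rewrite -[x^-1]mul1g; apply: nsetF nset1 Nx. Qed.

Lemma nsetM x y : nset N x -> nset N y -> nset N (x * y).
Proof. by move=> Nx Ny; rewrite -[y]invgK; apply/nsetF/nsetV. Qed.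

End Subgroups.

(* The quotient group G / N; \pi_(quot N) g is the coset g N. *)
Section Quotient.
Variables (G : groupType) (N : nsubgroup G).

Definition eq_coset : rel G := fun x y => `[< nset N (x^-1 * y) >].

Fact eq_coset_refl : reflexive eq_coset.
Proof. by move=> x; apply/asboolP; rewrite mulVg; apply: nset1. Qed.

Fact eq_coset_sym : symmetric eq_coset.
Proof.
move=> x y; rewrite /eq_coset; congr asbool; apply/propext.
by split=> /nsetV; rewrite invgM invgK.
Qed.

Fact eq_coset_trans : transitive eq_coset.
Proof.
move=> y x z /asboolP xy /asboolP yz; apply/asboolP.
by have := nsetM xy yz; rewrite mulgA mulgK.
Qed.

Canonical eq_coset_equiv :=
  EquivRel eq_coset eq_coset_refl eq_coset_sym eq_coset_trans.
Canonical eq_coset_direct := defaultEncModRel eq_coset.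

Definition quot : Type := {eq_quot eq_coset}.

HB.instance Definition _ := Choice.on quot.
HB.instance Definition _ : EqQuotient G eq_coset quot := EqQuotient.on quot.

Lemma quotP x y : \pi_quot x = \pi_quot y <-> nset N (x^-1 * y).
Proof. by split=> [/eqmodP/asboolP //|H]; apply/eqmodP/asboolP. Qed.

Definition quot_one : quot := \pi_quot 1.
Definition quot_mul (u v : quot) : quot := \pi_quot (repr u * repr v).
Definition quot_inv (u : quot) : quot := \pi_quot (repr u)^-1.

Lemma repr_quot x : exists2 h, nset N h & repr (\pi_quot x) = x * h.
Proof.
exists (x^-1 * repr (\pi_quot x)); last by rewrite mulVKg.
by apply/quotP; rewrite reprK.
Qed.

Lemma pi_quotM x y : \pi_quot (x * y) = quot_mul (\pi_quot x) (\pi_quot y).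
Proof.
have [h Nh eh] := repr_quot x; have [k Nk ek] := repr_quot y.
apply/quotP; rewrite eh ek.
have -> : (x * y)^-1 * (x * h * (y * k)) = (h ^ y) * k.
  by rewrite /conjg invgM !mulgA; congr (_ * _ * _); rewrite mulgVK.
exact/nsetM/Nk/nset_conj.
Qed.

Lemma pi_quotV x : \pi_quot x^-1 = quot_inv (\pi_quot x).
Proof.
have [h Nh eh] := repr_quot x; apply/quotP.
rewrite eh invgM invgK mulgA.
have -> : x * h^-1 * x^-1 = h^-1 ^ x^-1 by rewrite /conjg invgK mulgA.
exact/nset_conj/nsetV.
Qed.

Lemma quot_ind (P : quot -> Prop) : (forall x, P (\pi_quot x)) -> forall u, P u.
Proof. by move=> Ppi u; rewrite -[u]reprK; apply: Ppi. Qed.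

Fact quot_mulA : associative quot_mul.
Proof.
elim/quot_ind=> x; elim/quot_ind=> y; elim/quot_ind=> z.
by rewrite -(pi_quotM y) -(pi_quotM x y) -(pi_quotM x) -(pi_quotM (x * y)) mulgA.
Qed.
Fact quot_mul1 : left_id quot_one quot_mul.
Proof. by elim/quot_ind=> x; rewrite -(pi_quotM 1) mul1g. Qed.
Fact quot_mulr1 : right_id quot_one quot_mul.
Proof. by elim/quot_ind=> x; rewrite -(pi_quotM x) mulg1. Qed.
Fact quot_mulV : left_inverse quot_one quot_inv quot_mul.
Proof. by elim/quot_ind=> x; rewrite -(pi_quotV x) -(pi_quotM x^-1) mulVg. Qed.
Fact quot_mulrV : right_inverse quot_one quot_inv quot_mul.
Proof. by elim/quot_ind=> x; rewrite -(pi_quotV x) -(pi_quotM x) mulgV. Qed.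

HB.instance Definition _ := isGroup.Build quot
  quot_mulA quot_mul1 quot_mulr1 quot_mulV quot_mulrV.

Lemma quotM x y : \pi_quot (x * y) = \pi_quot x * \pi_quot y.
Proof. exact: pi_quotM. Qed.
Lemma quot1 : \pi_quot 1 = 1. Proof. by []. Qed.
Lemma quotV x : \pi_quot x^-1 = (\pi_quot x)^-1.
Proof. exact: pi_quotV. Qed.
Lemma quotJ x y : \pi_quot (x ^ y) = \pi_quot x ^ \pi_quot y.
Proof. by rewrite /conjg !quotM quotV. Qed.

End Quotient.

(* The homomorphism G / N -> H / M, g N |-> phi(g) M, induced by phi. *)
Section InducedHom.
Variables (G H : groupType) (N : nsubgroup G) (M : nsubgroup H).
Variables (phi : {ghom G -> H}) (phiNM : phi @` N = M).

(* phiNM is kept as an argument so that the HB instance below can use it. *)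
Definition induced_fun of phi @` N = M :=
  fun u : quot N => \pi_(quot M) (phi (repr u)).

Lemma induced_funE x : induced_fun phiNM (\pi_(quot N) x) = \pi_(quot M) (phi x).
Proof.
have [h Nh eh] := repr_quot N x; rewrite /induced_fun eh gmulfM quotM.
have Mh : nset M (phi h) by rewrite -phiNM; exists h.
rewrite -[RHS]mulg1; congr (_ * _); apply/quotP; rewrite mulg1.
exact: nsetV.
Qed.

Fact induced_is_morphism : {morph induced_fun phiNM : u v / u / v}.
Proof.
elim/quot_ind=> x; elim/quot_ind=> y.
by rewrite -quotV -quotM !induced_funE gmulfF quotM quotV.
Qed.

HB.instance Definition _ := isGroupMorphism.Build _ _ (induced_fun phiNM)
  induced_is_morphism.

Definition induced_hom : {ghom quot N -> quot M} := induced_fun phiNM.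

End InducedHom.

(* The factor H / K as a subset of G / K. *)
Definition factor_set (G : groupType) (H K : nsubgroup G) : set (quot K) :=
  [set \pi_(quot K) x | x in nset H].
Arguments factor_set {G} H K _.

Definition abelian_factor (G : groupType) (H K : nsubgroup G) :=
  forall u v, factor_set H K u -> factor_set H K v -> u * v = v * u.

(* An abelian factor H / K, written additively. *)
Section Factor.
Variables (G : groupType) (H K : nsubgroup G) (abHK : abelian_factor H K).

Record factor (ab : abelian_factor H K) :=
  Factor { factor_val : quot K; _ : `[< factor_set H K factor_val >] }.

Local Notation F := (factor abHK).

HB.instance Definition _ := [isSub for @factor_val abHK].
HB.instance Definition _ := [Choice of F by <:].

Lemma factorP (u : F) : factor_set H K (\val u).
Proof. exact/asboolP/(valP u). Qed.

Definition mk_factor u (Hu : factor_set H K u) : F := Factor abHK (asboolT Hu).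

Lemma factor_set1 : factor_set H K 1.
Proof. by exists 1 => //; apply: nset1. Qed.

Lemma factor_setM u v :
  factor_set H K u -> factor_set H K v -> factor_set H K (u * v).
Proof.
move=> [x Hx <-] [y Hy <-]; exists (x * y); last exact: quotM.
exact: nsetM.
Qed.

Lemma factor_setV u : factor_set H K u -> factor_set H K u^-1.
Proof.
by move=> [x Hx <-]; exists x^-1; [exact: nsetV | exact: quotV].
Qed.

Lemma factor_setJ u v : factor_set H K u -> factor_set H K (u ^ v).
Proof.
elim/quot_ind: v => g [x Hx <-]; exists (x ^ g); last exact: quotJ.
exact: nset_conj.
Qed.

Definition factor_zero : F := mk_factor factor_set1.
Definition factor_add (u v : F) : F :=
  mk_factor (factor_setM (factorP u) (factorP v)).
Definition factor_opp (u : F) : F := mk_factor (factor_setV (factorP u)).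

Fact factor_addA : associative factor_add.
Proof. by move=> u v w; apply/val_inj; rewrite /= mulgA. Qed.
Fact factor_addC : commutative factor_add.
Proof. by move=> u v; apply/val_inj/abHK; apply: factorP. Qed.
Fact factor_add0 : left_id factor_zero factor_add.
Proof. by move=> u; apply/val_inj; rewrite /= mul1g. Qed.
Fact factor_addN : left_inverse factor_zero factor_opp factor_add.
Proof. by move=> u; apply/val_inj; rewrite /= mulVg. Qed.

HB.instance Definition _ := GRing.isZmodule.Build F
  factor_addA factor_addC factor_add0 factor_addN.

(* The action x . (g H) = x ^ g of G / H on H / K induced by conjugation. *)
Definition factor_act (u : F) (q : quot H) : F :=
  mk_factor (factor_setJ (\pi_(quot K) (repr q)) (factorP u)).

Lemma factor_actE u g :
  \val (factor_act u (\pi_(quot H) g)) = \val u ^ \pi_(quot K) g.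
Proof.
have [h Hh eh] := repr_quot H g; rewrite /= eh.
have [x Hx <-] := factorP u.
rewrite -!quotJ; have -> : x ^ (g * h) = (x ^ g) ^ h by rewrite conjgM.
rewrite quotJ conjgE [X in _ * X]abHK ?mulKg //; last by exists h.
by exists (x ^ g); first exact: nset_conj.
Qed.

Fact factor_act_zmod_morphism q : zmod_morphism (factor_act^~ q).
Proof. by move=> u v; apply/val_inj; rewrite /= conjMg conjVg. Qed.

Lemma factor_actD u v q :
  factor_act (u + v)%R q = (factor_act u q + factor_act v q)%R.
Proof. by apply/val_inj; rewrite /= conjMg. Qed.

Fact factor_act1 u : factor_act u 1 = u.
Proof. by apply/val_inj; rewrite -(quot1 H) factor_actE quot1 conjg1. Qed.

Fact factor_actM u q r : factor_act u (q * r) = factor_act (factor_act u q) r.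
Proof.
elim/quot_ind: q => g; elim/quot_ind: r => k.
by apply/val_inj; rewrite -quotM !factor_actE quotM conjgM.
Qed.

End Factor.

(* The integral group ring Z[Q]; << z *g q >> is z q. *)
Section GroupRing.
Local Open Scope ring_scope.
Variable Q : groupType.

Definition group_ring := {malg int[Q]}.

HB.instance Definition _ := GRing.Zmodule.on group_ring.

Definition gr (q : Q) : group_ring := << 1 *g q >>.

Section LinearExtension.
Variable V : zmodType.
Implicit Types (h : Q -> V) (r s : group_ring).

(* The additive extension of h : Q -> V to Z[Q]. *)
Definition gr_lift h r : V := \sum_(q <- msupp r) h q *~ r@_q.

Lemma gr_lift_widen h r (D : {fset Q}) :
  (msupp r `<=` D)%fset -> gr_lift h r = \sum_(q <- D) h q *~ r@_q.
Proof.
move=> rD; rewrite /gr_lift (big_fset_incl _ rD) // => q _ qr.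
by rewrite mcoeff_outdom.
Qed.

Fact gr_lift_zmod_morphism h : zmod_morphism (gr_lift h).
Proof.
move=> r s; pose D := (msupp r `|` msupp s)%fset.
rewrite !(@gr_lift_widen _ _ D) ?fsubsetUl ?fsubsetUr ?msuppB_le //.
by rewrite -sumrB; apply: eq_bigr => q _; rewrite mcoeffB mulrzBr.
Qed.

HB.instance Definition _ h := GRing.isZmodMorphism.Build group_ring V
  (gr_lift h) (gr_lift_zmod_morphism h).

Lemma gr_lift1 h q : gr_lift h (gr q) = h q.
Proof.
by rewrite (@gr_lift_widen _ _ [fset q]%fset) ?msuppU_le // big_seq_fset1 mcoeffUU.
Qed.

Lemma eq_gr_lift h h' : h =1 h' -> gr_lift h =1 gr_lift h'.
Proof. by move=> hh' r; apply: eq_bigr => q _; rewrite hh'. Qed.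

Lemma gr_liftD h h' r :
  gr_lift (fun q => h q + h' q) r = gr_lift h r + gr_lift h' r.
Proof. by rewrite -big_split; apply: eq_bigr => q _; rewrite mulrzDl. Qed.

End LinearExtension.

Lemma raddf_gr_lift (V W : zmodType) (f : {additive V -> W}) (h : Q -> V) r :
  f (gr_lift h r) = gr_lift (f \o h) r.
Proof. by rewrite raddf_sum; apply: eq_bigr => q _; rewrite raddfMz. Qed.

Lemma gr_liftE r : gr_lift gr r = r.
Proof.
rewrite [RHS]monalgE; apply: eq_bigr => q _.
by rewrite -[LHS]raddfMz intz.
Qed.

Lemma gr_lift_eq (V : zmodType) (f g : {additive group_ring -> V}) :
  (forall q, f (gr q) = g (gr q)) -> f =1 g.
Proof.
move=> fg r; rewrite -[r]gr_liftE !raddf_gr_lift.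
exact: eq_gr_lift.
Qed.

(* The convolution product: (\sum_q r_q q) (\sum_q' s_q' q') is               *)
(* \sum_q \sum_q' r_q s_q' (q q').                                            *)
Definition gr_mul (r s : group_ring) : group_ring :=
  gr_lift (fun q => gr_lift (fun q' => gr (q * q')%g) s) r.

Fact gr_mulDl : left_distributive gr_mul +%R.
Proof. by move=> r s t; rewrite /gr_mul raddfD. Qed.

Fact gr_mulDr : right_distributive gr_mul +%R.
Proof.
move=> r s t; rewrite /gr_mul -gr_liftD.
by apply: eq_gr_lift => q; rewrite raddfD.
Qed.

Lemma gr_mul_gr q r : gr_mul (gr q) r = gr_lift (fun q' => gr (q * q')%g) r.
Proof. exact: gr_lift1. Qed.

Lemma grM q q' : gr_mul (gr q) (gr q') = gr (q * q')%g.
Proof. by rewrite gr_mul_gr gr_lift1. Qed.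

Fact gr_mulA : associative gr_mul.
Proof.
move=> r s t; rewrite /gr_mul [in RHS]raddf_gr_lift; apply: eq_gr_lift => q /=.
rewrite !raddf_gr_lift; apply: eq_gr_lift => a /=.
rewrite gr_lift1 raddf_gr_lift; apply: eq_gr_lift => b /=.
by rewrite gr_lift1 mulgA.
Qed.

Fact gr_mul1 : left_id (gr 1%g) gr_mul.
Proof.
move=> r; rewrite gr_mul_gr -[RHS]gr_liftE.
by apply: eq_gr_lift => q; rewrite mul1g.
Qed.

Fact gr_mulr1 : right_id (gr 1%g) gr_mul.
Proof.
move=> r; rewrite -[RHS]gr_liftE.
by apply: eq_gr_lift => q; rewrite gr_lift1 mulg1.
Qed.

HB.instance Definition _ := GRing.Zmodule_isPzRing.Build group_ring
  gr_mulA gr_mul1 gr_mulr1 gr_mulDl gr_mulDr.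

End GroupRing.

Lemma gr_liftC (Q Q' : groupType) (V : zmodType) (h : Q -> Q' -> V) r s :
  gr_lift (fun q => gr_lift (h q) s) r = gr_lift (fun q' => gr_lift (h^~ q') r) s.
Proof.
rewrite /gr_lift; under eq_bigr do rewrite mulrz_suml.
rewrite exchange_big; apply: eq_bigr => q' _ /=.
by rewrite mulrz_suml; apply: eq_bigr => q _; rewrite -!mulrzA mulrC.
Qed.

Section RightModules.
Local Open Scope ring_scope.

(* MathComp only has left modules: a right R-module is a left module over the *)
(* converse ring R^c, and r *: x is the right action x r.                     *)
Definition no_torsion (R : pzRingType) (T : lmodType R^c) :=
  forall (x : T) (r : R), (r : R^c) *: x = 0 -> x = 0 \/ r = 0.

Variables (G : groupType) (H K : nsubgroup G) (abHK : abelian_factor H K).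

(* x (\sum_q r_q q) = \sum_q r_q (x . q) *)
Definition factor_scale (r : (group_ring (quot H))^c) (x : factor abHK) :
    factor abHK :=
  gr_lift (factor_act x) r.

Lemma factor_act_lift (h : quot H -> factor abHK) r q :
  factor_act (gr_lift h r) q = gr_lift (fun q' => factor_act (h q') q) r.
Proof.
pose m := GRing.isZmodMorphism.Build _ _ _ (@factor_act_zmod_morphism _ _ _ abHK q).
pose f : {additive factor abHK -> factor abHK} :=
  HB.pack (fun u : factor abHK => factor_act u q) m.
exact: (raddf_gr_lift f).
Qed.

Fact factor_scaleA r s x :
  factor_scale r (factor_scale s x) = factor_scale (r * s) x.
Proof.
rewrite /factor_scale [RHS]raddf_gr_lift.
under eq_gr_lift do rewrite factor_act_lift.
rewrite gr_liftC; apply: eq_gr_lift => q /=.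
rewrite raddf_gr_lift; apply: eq_gr_lift => q' /=.
by rewrite gr_lift1 factor_actM.
Qed.

Fact factor_scale1 : left_id 1 factor_scale.
Proof. by move=> x; rewrite /factor_scale gr_lift1 factor_act1. Qed.

Fact factor_scaleDr : right_distributive factor_scale +%R.
Proof.
move=> r x y; rewrite /factor_scale -gr_liftD.
by apply: eq_gr_lift => q; rewrite factor_actD.
Qed.

Fact factor_scaleDl x : {morph factor_scale^~ x : r s / r + s}.
Proof. by move=> r s; rewrite /factor_scale raddfD. Qed.

HB.instance Definition _ := GRing.Zmodule_isLmodule.Build
  (group_ring (quot H))^c (factor abHK)
  factor_scaleA factor_scale1 factor_scaleDr factor_scaleDl.

Lemma factor_scaleE (r : (group_ring (quot H))^c) (x : factor abHK) :
  r *: x = gr_lift (factor_act x) r.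
Proof. by []. Qed.

End RightModules.

(* A principal series G = S_1 > S_2 > ... > S_n > S_(n+1) = 1; the values of  *)
(* S outside of 1, ..., n+1 are irrelevant.                                   *)
Definition principal_series (n : nat) (G : groupType) (S : nat -> nsubgroup G) :=
  [/\ S 1%N = [set: G] :> set G,
      S n.+1 = [set 1] :> set G &
      forall i, (1 <= i <= n)%N ->
        (S i.+1 : set G) `<` S i /\
        exists ab : abelian_factor (S i) (S i.+1),
          @no_torsion (group_ring (quot (S i))) (factor ab)].

Definition rigid (G : groupType) :=
  exists n (S : nat -> nsubgroup G), principal_series n S.

Definition n_rigid (n : nat) (G : groupType) :=
  rigid G /\ solvability_class G n.

Definition discriminates (G A : groupType) (Phi : set {ghom G -> A}) :=
  forall K : set G, finite_set K -> exists2 phi, Phi phi & set_inj K phi.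

(* Here A is a subgroup of G, with inclusion \val : A -> G. *)
Section AHom.
Variables (G : groupType) (P : {pred G}) (A : subGroupType P).
Implicit Type phi : {ghom G -> A}.

Definition A_homomorphism phi := forall a : A, phi (\val a) = a.

Definition A_epimorphism phi :=
  (forall a, exists g, phi g = a) /\ A_homomorphism phi.

Definition A_discriminates (Phi : set {ghom G -> A}) :=
  discriminates Phi /\ forall phi, Phi phi -> A_homomorphism phi.

End AHom.

Definition induced (G H : groupType) (Phi : set {ghom G -> H})
    (N : nsubgroup G) (M : nsubgroup H) : set {ghom quot N -> quot M} :=
  [set psi | exists2 phi, Phi phi &
               exists phiNM : phi @` N = M, psi = induced_hom phiNM].
Arguments induced {G H} Phi N M _.

(* Main.v *)
(* Let G_i be the set of the g with g phi in A_i for every phi in Phi. Since   *)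
(* each phi is the identity on A, G_i contains A_i and G_i phi = A_i. In a     *)
(* principal series, g lies in S_i iff [a, g] lies in S_(i+1), for any a in    *)
(* S_i \ S_(i+1); iterating with constants taken from A, an element g outside  *)
(* G_i has an iterated commutator h <> 1 such that h phi <> 1 forces           *)
(* g phi outside A_i. Hence Phi separates finitely many elements simultaneously*)
(* from the G_i, which gives the discrimination of G / G_i and transfers the   *)
(* absence of torsion from A_i / A_(i+1) to G_i / G_(i+1). The same            *)
(* description of S_i by centralizers shows, by downward induction, that the   *)
(* principal series is unique.                                                 *)
Require Import Defs.
From mathcomp Require Import all_boot classical_sets.
From HB Require Import structures.
From mathcomp Require Import all_algebra finmap monalg boolp cardinality zify.

Set Implicit Arguments.
Unset Strict Implicit.
Unset Printing Implicit Defensive.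

Import GRing.Theory.

Local Open Scope classical_set_scope.
Local Open Scope group_scope.
Local Open Scope quotient_scope.

(** Take G_i = [radical (A_ i)], the intersection of the preimages of A_i under [Phi]. Its factors
    inherit commutativity from A at once; torsion needs a single phi in place of all of [Phi]. By
    [radical_witness], g outside G_i yields some h <> 1 such that every phi with phi h <> 1 sends g
    outside A_i, so discrimination meets finitely many such conditions with one phi
    ([radical_separate]). A relation x r = 0 with x <> 0 is then carried to A_i / A_(i+1) with the
    image of x nonzero and the support of r mapped injectively, which forces r = 0
    ([radical_no_torsion]). [principal_series_unique] passes from this series to any principal
    series of G. *)

Lemma quot_conj_fix (G : groupType) (N : nsubgroup G) x y :
  \pi_(quot N) x ^ \pi_(quot N) y = \pi_(quot N) x <-> nset N [~ x, y].
Proof. by rewrite -quotJ commgEl; split=> [/esym/Defs.quotP|H] //; apply/esym/Defs.quotP. Qed.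

Lemma abelian_factorP (G : groupType) (H K : nsubgroup G) :
  abelian_factor H K <-> forall x y, nset H x -> nset H y -> nset K [~ x, y].
Proof.
split=> [ab x y Hx Hy | abHK u v].
  by apply/quot_conj_fix; rewrite conjgE [X in _ * X]ab ?mulKg //; [exists x | exists y].
case=> x Hx <- [y Hy <-]; have /quot_conj_fix := abHK _ _ Hx Hy.
by rewrite conjgE => {2}<-; rewrite mulVKg.
Qed.

(** * Centralizers in a principal series, and its uniqueness *)

Section PrincipalSeries.
Variables (n : nat) (G : groupType) (S : nat -> nsubgroup G).
Hypothesis serS : principal_series n S.

Lemma principal_series_sub i : (1 <= i <= n)%N -> nset (S i.+1) `<=` nset (S i).
Proof. by case: serS => _ _ h /h [[]]. Qed.

Lemma principal_series_proper i : (1 <= i <= n)%N ->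
  exists2 a, nset (S i) a & ~ nset (S i.+1) a.
Proof.
case: serS => _ _ h /h [[_ nsub] _]; apply: contrapT => none; apply: nsub => a Sa.
by apply: contrapT => Ka; apply: none; exists a.
Qed.

Lemma principal_series_commg i x y : (1 <= i <= n)%N ->
  nset (S i) x -> nset (S i) y -> nset (S i.+1) [~ x, y].
Proof. by case: serS => _ _ h /h [_ [/abelian_factorP ab _]]; apply: ab. Qed.

(* If g centralizes a modulo S_(i+1), then g - 1 kills the class of a in the  *)
(* torsion-free module S_i / S_(i+1), so g = 1 modulo S_i.                    *)
Lemma principal_series_cent i a g : (1 <= i <= n)%N ->
  nset (S i) a -> ~ nset (S i.+1) a ->
  nset (S i.+1) [~ a, g] -> nset (S i) g.
Proof.
move=> le_i Sa S'a; case: serS => _ _ /(_ i le_i) [_ [ab noT]].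
move=> /quot_conj_fix ag.
have Fa : factor_set (S i) (S i.+1) (\pi_(quot (S i.+1)) a) by exists a.
pose x := mk_factor ab Fa.
pose r : group_ring (quot (S i)) := (gr (\pi_(quot (S i)) g) - gr 1)%R.
have : ((r : (group_ring (quot (S i)))^c) *: x = 0)%R.
  rewrite factor_scaleE raddfB /= !gr_lift1 factor_act1.
  suff -> : factor_act x (\pi_(quot (S i)) g) = x by rewrite subrr.
  by apply/val_inj; rewrite factor_actE.
case/noT=> [/(congr1 val) /= x0 | /eqP].
  by case: S'a; have /Defs.quotP := esym x0; rewrite invg1 mul1g.
rewrite subr_eq0 => /eqP /(congr1 (mcoeff 1)).
rewrite /gr mcoeffUU mcoeffU; case: eqP => // g1 _.
by have /Defs.quotP := esym g1; rewrite invg1 mul1g.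
Qed.

Lemma derived_sub k : (k <= n)%N -> @derived G k `<=` nset (S k.+1).
Proof.
elim: k => [|k IHk] lekn; first by case: serS => ->.
apply: smallest_sub; first exact: nset_subgroup.
move=> _ [x Dx [y Dy <-]]; have le_kn := ltnW lekn.
by apply: principal_series_commg => //; apply: IHk.
Qed.

End PrincipalSeries.

(** If S_i and T_i share an element x outside the common next term, each g in S_i centralizes x
    modulo that term, hence lies in T_i. Otherwise S_i and T_i meet inside that term, which
    therefore contains [y, g] for y in T_i and g in S_i, and y serves instead of x. *)
Lemma principal_series_subset_step n (G : groupType) (S T : nat -> nsubgroup G) i :
    principal_series n S -> principal_series n T -> (1 <= i <= n)%N ->
  nset (S i.+1) = nset (T i.+1) -> nset (S i) `<=` nset (T i).
Proof.
move=> serS serT le_i eqN.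
have [y Ty T'y] := principal_series_proper serT le_i.
have [[x Sx [Tx S'x]] | disj] :=
  pselect (exists2 x, nset (S i) x & nset (T i) x /\ ~ nset (S i.+1) x).
  move=> g Sg; apply: (principal_series_cent serT le_i Tx); rewrite -eqN //.
  exact: (principal_series_commg serS).
move=> g Sg; apply: (principal_series_cent serT le_i Ty T'y).
rewrite -eqN; apply: contrapT => S'yg; apply: disj; exists [~ y, g] => //.
  by rewrite -invgR; apply/nsetV; apply: nsetM; [exact: nsetV | exact: nset_conj].
by split=> //; apply: nsetM; [exact: nsetV | exact: nset_conj].
Qed.

Lemma principal_series_unique n (G : groupType) (S T : nat -> nsubgroup G) :
    principal_series n S -> principal_series n T ->
  forall i, (1 <= i <= n.+1)%N -> nset (S i) = nset (T i).
Proof.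
move=> serS serT i /andP[i_gt0 lein].
(* Writing i as n+1-k turns the descent from S_(n+1) = 1 into induction on k. *)
rewrite -(subKn lein); have : (n.+1 - i <= n)%N by lia.
elim: (_ - i)%N => [|k IHk] lekn.
  by rewrite subn0; case: serS serT => _ -> _ [_ ->].
have IH := IHk (ltnW lekn).
have e : (n.+1 - k = (n.+1 - k.+1).+1)%N by lia.
have le_k : (1 <= n.+1 - k.+1 <= n)%N by lia.
by apply/seteqP; split; apply: (principal_series_subset_step _ _ le_k) => //;
  rewrite -e.
Qed.

(** * Derived subgroups, factors and group rings under homomorphisms *)

Lemma derived_morph (G H : groupType) (f : {ghom G -> H}) k x :
  @derived G k x -> @derived H k (f x).
Proof.
elim: k x => // k IHk x; move: x.
apply: smallest_sub.
  split=> [K [[K1 _] _] | x y Dx Dy K [subK commK]]; first by rewrite gmulf1.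
  by rewrite /= gmulfF; apply: subK.2; [apply: Dx | apply: Dy].
move=> _ [x Dx [y Dy <-]] K [_ commK]; apply: commK.
by rewrite gmulfR; exists (f x); [exact: IHk | exists (f y); [exact: IHk |]].
Qed.

Lemma derived1 (G : groupType) k : @derived G k 1.
Proof. by case: k => // k; move=> K [[]]. Qed.

Lemma induced_homE (G H : groupType) (N : nsubgroup G) (M : nsubgroup H)
    (phi : {ghom G -> H}) (phiN : phi @` N = M) x :
  induced_hom phiN (\pi_(quot N) x) = \pi_(quot M) (phi x).
Proof. exact: induced_funE. Qed.

Section FactorMorphism.
Variables (G H : groupType) (N N' : nsubgroup G) (M M' : nsubgroup H).
Variables (phi : {ghom G -> H}) (phiN : phi @` N = M) (phiN' : phi @` N' = M').
Variables (abN : abelian_factor N N') (abM : abelian_factor M M').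

Lemma induced_factor_set u :
  factor_set N N' u -> factor_set M M' (induced_hom phiN' u).
Proof.
case=> x Nx <-; exists (phi x); first by rewrite -phiN; exists x.
by rewrite induced_homE.
Qed.

Definition factor_map (u : factor abN) : factor abM :=
  mk_factor abM (induced_factor_set (factorP u)).

Fact factor_map_is_zmod_morphism : zmod_morphism factor_map.
Proof. by move=> u v; apply/val_inj; rewrite /= gmulfM gmulfV. Qed.

HB.instance Definition _ := GRing.isZmodMorphism.Build _ _ factor_map
  factor_map_is_zmod_morphism.

Lemma factor_map_act u q :
  factor_map (factor_act u q) = factor_act (factor_map u) (induced_hom phiN q).
Proof.
elim/quot_ind: q => g; apply/val_inj.
have valE w : \val (factor_map w) = induced_hom phiN' (\val w) by [].
by rewrite valE factor_actE gmulfJ !induced_homE factor_actE.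
Qed.

(** Semilinearity of [factor_map]: the [gr_lift] on the right is the map Z[G/N] -> Z[H/M] induced by
    [phi]. It carries torsion relations from G to H. *)
Lemma factor_map_scale (r : group_ring (quot N)) u :
  factor_map ((r : (group_ring (quot N))^c) *: u)%R =
  ((gr_lift (fun q => gr (induced_hom phiN q)) r : (group_ring (quot M))^c)
     *: factor_map u)%R.
Proof.
rewrite !factor_scaleE !raddf_gr_lift; apply: eq_gr_lift => q /=.
by rewrite gr_lift1 factor_map_act.
Qed.

End FactorMorphism.

(** Injectivity on the support excludes cancellation: the image has at f q0 the coefficient of r at
    q0. *)
Lemma gr_lift_gr_eq0 (Q Q' : groupType) (f : Q -> Q') (r : group_ring Q) :
    {in msupp r &, injective f} ->
  gr_lift (fun q => gr (f q)) r = 0%R -> r = 0%R.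
Proof.
move=> inj_f r0; apply/malgP => q0; rewrite mcoeff0; apply/eqP.
rewrite mcoeff_eq0; apply/negP => q0r.
have /eqP[] : (r@_q0 != 0)%R by rewrite mcoeff_neq0.
have := congr1 (mcoeff (f q0)) r0; rewrite mcoeff0 => <-.
rewrite /gr_lift raddf_sum (big_fsetD1 q0) //= raddfMz /= mcoeffUU intz.
rewrite big_seq big1 ?addr0 // => q; rewrite in_fsetD1 => /andP[qq0 qr].
rewrite raddfMz /= mcoeffU; case: eqP => [/inj_f|]; last by rewrite mul0rz.
by move=> /(_ qr q0r) e; rewrite e eqxx in qq0.
Qed.

(** * The series of radicals in a discriminated group *)

Section Discriminated.
Variables (n : nat) (G A : groupType) (iota : {ghom A -> G}).
Variables (Phi : set {ghom G -> A}) (A_ : nat -> nsubgroup A).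
Hypothesis serA : principal_series n A_.
Hypothesis Phi_id : forall phi, Phi phi -> cancel iota phi.
Hypothesis Phi_disc : discriminates Phi.

Fact radical_subgroup (M : nsubgroup A) :
  is_subgroup [set g | forall phi, Phi phi -> nset M (phi g)].
Proof.
split=> [phi _ | x y Rx Ry phi Pphi]; first by rewrite gmulf1; apply: nset1.
by rewrite gmulfF; apply: nsetF; [apply: Rx | apply: Ry].
Qed.

Fact radical_conj (M : nsubgroup A) x g :
  [set g | forall phi, Phi phi -> nset M (phi g)] x ->
  [set g | forall phi, Phi phi -> nset M (phi g)] (x ^ g).
Proof. by move=> Rx phi /Rx Mx; rewrite gmulfJ; apply: nset_conj. Qed.

Definition radical (M : nsubgroup A) : nsubgroup G :=
  NSubgroup (radical_subgroup M) (@radical_conj M).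

Lemma radical_iota (M : nsubgroup A) a : nset M a -> nset (radical M) (iota a).
Proof. by move=> Ma phi Pphi; rewrite Phi_id. Qed.

Lemma radical_image (M : nsubgroup A) phi :
  Phi phi -> phi @` radical M = nset M.
Proof.
move=> Pphi; apply/seteqP; split=> [_ [g Rg <-] | a Ma]; first exact: Rg.
by exists (iota a); [exact: radical_iota | exact: Phi_id].
Qed.

(* [h] is the iterated commutator [a_n, ..., [a_i, g]] with a_j in            *)
(* A_j \ A_(j+1), which by principal_series_cent detects whether g is in A_i. *)
Lemma radical_witness i g : (1 <= i <= n.+1)%N -> ~ nset (radical (A_ i)) g ->
  exists2 h, h <> 1 &
    forall phi, Phi phi -> phi h <> 1 -> ~ nset (A_ i) (phi g).
Proof.
move=> /andP[i_gt0 lein]; rewrite -(subKn lein).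
have : (n.+1 - i <= n)%N by lia.
elim: (_ - i)%N g => [|k IHk] g lekn.
  have -> : nset (A_ (n.+1 - 0)) = [set 1] by rewrite subn0; case: serA.
  move=> Rg; exists g => [g1 | //]; apply: Rg => phi _.
  by rewrite g1 gmulf1; apply: nset1.
have le_k : (1 <= n.+1 - k.+1 <= n)%N by lia.
have e : (n.+1 - k = (n.+1 - k.+1).+1)%N by lia.
have [a Aa A'a] := principal_series_proper serA le_k => Rg.
(* Every phi sends [iota a] back to a, so the centralizer criterion in A applies to phi g. *)
have Rag : ~ nset (radical (A_ (n.+1 - k))) [~ iota a, g].
  move=> Rag; apply: Rg => phi Pphi.
  apply: (principal_series_cent serA le_k Aa A'a).
  by rewrite -e -[X in [~ X, _]](Phi_id Pphi) -gmulfR; apply: Rag.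
have [h h1 hP] := IHk _ (ltnW lekn) Rag; exists h => // phi Pphi phih Ag.
apply: (hP _ Pphi phih); rewrite gmulfR Phi_id // e.
exact: (principal_series_commg serA).
Qed.

Lemma radical_separate (s : seq (nat * G)) :
    (forall p, p \in s ->
       (1 <= p.1 <= n.+1)%N /\ ~ nset (radical (A_ p.1)) p.2) ->
  exists2 phi, Phi phi & forall p, p \in s -> ~ nset (A_ p.1) (phi p.2).
Proof.
move=> sP.
have [hs hs1 hsP] : exists2 hs : seq G, (forall h, h \in hs -> h <> 1) &
    forall phi, Phi phi -> (forall h, h \in hs -> phi h <> 1) ->
      forall p, p \in s -> ~ nset (A_ p.1) (phi p.2).
  elim: s sP => [|p s IHs] sP; first by exists [::].
  have [q qs|hs hs1 hsP] := IHs; first by apply: sP; rewrite inE qs orbT.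
  have [lep Rp] := sP p (mem_head _ _).
  have [h h1 hP] := radical_witness lep Rp.
  exists (h :: hs) => [k | phi Pphi nz q].
    by rewrite inE => /predU1P[-> // | /hs1].
  rewrite inE => /predU1P[-> | qs].
    by apply: hP => //; apply: nz; exact: mem_head.
  by apply: (hsP phi) => // k khs; apply: nz; rewrite inE khs orbT.
(* With 1 in the finite set, injectivity keeps every witness away from 1. *)
have [phi Pphi injphi] := Phi_disc (finite_seq (1 :: hs)).
exists phi => //; apply: hsP => // h hhs phih; apply: (hs1 h hhs).
apply: injphi; last by rewrite phih gmulf1.
  by apply/mem_set; rewrite /= inE hhs orbT.
by apply/mem_set; rewrite /= mem_head.
Qed.

(** Distinct cosets u, v in [K] give an element u^-1 v outside the radical; these elements are added
    to [s]. Only the underlying set of [N] is prescribed, so that [N] may also be a term of a given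
    principal series of G. *)
Lemma radical_separate_quot i (N : nsubgroup G) (K : seq (quot N))
    (s : seq (nat * G)) :
    (1 <= i <= n.+1)%N -> nset N = nset (radical (A_ i)) ->
    (forall p, p \in s ->
       (1 <= p.1 <= n.+1)%N /\ ~ nset (radical (A_ p.1)) p.2) ->
  exists2 phi, Phi phi & (forall p, p \in s -> ~ nset (A_ p.1) (phi p.2)) /\
    forall phiN : phi @` N = A_ i, {in K &, injective (induced_hom phiN)}.
Proof.
move=> le_i eqN sP.
pose d (p : quot N * quot N) := (i, (repr p.1)^-1 * repr p.2).
pose ps := [seq d p | p <- allpairs pair K K & p.1 != p.2].
have [p|phi Pphi phiP] := radical_separate (s := s ++ ps).
  rewrite mem_cat => /orP[/sP // | /mapP[[u v]]].
  rewrite mem_filter => /andP[/= /eqP uv _ ->]; split; first by [].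
  move=> Rq; have : nset N ((repr u)^-1 * repr v) by rewrite eqN; apply: Rq.
  by move=> /Defs.quotP; rewrite !reprK.
exists phi => //; split=> [p ps_p | phiN u v us vs uv].
  by apply: phiP; rewrite mem_cat ps_p.
apply/eqP/negPn/negP => neq_uv; apply: (phiP (d (u, v))).
  rewrite mem_cat; apply/orP; right; apply/mapP; exists (u, v) => //.
  by rewrite mem_filter /= neq_uv; apply/allpairsP; exists (u, v).
rewrite /= gmulfM gmulfV; apply/Defs.quotP.
by rewrite -!(induced_homE phiN) !reprK.
Qed.

Lemma radical_no_torsion i (le_i : (1 <= i <= n)%N)
    (ab : abelian_factor (radical (A_ i)) (radical (A_ i.+1))) :
  @no_torsion (group_ring (quot (radical (A_ i)))) (factor ab).
Proof.
have [_ _ /(_ i le_i) [_ [abA noT]]] := serA.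
move=> x r xr0; have [g Rg eg] := factorP x.
have [R'g | R'g] := pselect (nset (radical (A_ i.+1)) g).
  left; apply/val_inj; rewrite /= -eg.
  by apply/esym/Defs.quotP; rewrite invg1 mul1g.
have le_i1 : (1 <= i <= n.+1)%N by lia.
(* One phi both keeps x nonzero, at level i+1, and separates the support of r, at level i. *)
have [p|phi Pphi [A'g inj]] :=
    radical_separate_quot (enum_fset (msupp r)) (s := [:: (i.+1, g)]) le_i1 erefl.
  by rewrite inE => /eqP ->; split=> //=; lia.
have {}A'g := A'g _ (mem_head _ _).
have inj_r := inj (radical_image _ Pphi).
right; apply: (gr_lift_gr_eq0 inj_r).
have := factor_map_scale (radical_image _ Pphi) (radical_image _ Pphi) abA r x.
rewrite [X in factor_map _ _ _ X]xr0 raddf0 => /esym Fxr0.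
have [/(congr1 val)/= | //] := noT _ _ Fxr0.
rewrite -eg induced_homE => /esym/Defs.quotP.
by rewrite invg1 mul1g.
Qed.

Lemma radical_principal_series : principal_series n (fun i => radical (A_ i)).
Proof.
have [A1 An serAi] := serA; split=> [||i le_i].
- by apply/seteqP; split=> // g _ phi _; rewrite A1.
- apply/seteqP; split=> [g Rg | _ ->]; last exact: nset1.
  apply: contrapT => g1; have [phi Pphi injphi] := Phi_disc (finite_seq [:: 1; g]).
  apply/g1/injphi; try by apply/mem_set; rewrite /= !inE eqxx ?orbT.
  by have := Rg _ Pphi; rewrite An gmulf1.
have ab : abelian_factor (radical (A_ i)) (radical (A_ i.+1)).
  apply/abelian_factorP => x y Rx Ry phi Pphi; rewrite gmulfR.
  by apply: (principal_series_commg serA le_i); [exact: Rx | exact: Ry].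
split; last by exists ab; apply: radical_no_torsion.
split=> [g Rg phi Pphi | RS]; first exact/(principal_series_sub serA le_i)/Rg.
have [a Aa A'a] := principal_series_proper serA le_i.
(* Discriminating the empty set means that [Phi] is nonempty. *)
have [phi Pphi _] := Phi_disc (@finite_set0 G).
by apply: A'a; rewrite -[a](Phi_id Pphi); apply/RS/Pphi/radical_iota.
Qed.

(** The radical series bounds the class above by n; since [iota] is injective, the class of A bounds
    it below. *)
Lemma radical_solvability_class :
  solvability_class A n -> solvability_class G n.
Proof.
have serR := radical_principal_series; case=> _ nz; split=> [|j ltjn Dj].
  apply/seteqP; split=> [g Dg | _ ->]; last exact: derived1.
  by have [_ <- _] := serR; apply: (derived_sub serR (leqnn n)).
have [phi Pphi _] := Phi_disc (@finite_set0 G).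
apply: (nz j ltjn); apply/seteqP; split=> [a Da | _ ->]; last exact: derived1.
have := derived_morph iota Da; rewrite Dj => iota1.
by rewrite /= -[a](Phi_id Pphi) iota1 gmulf1.
Qed.

Lemma induced_discriminates i (N : nsubgroup G) :
    (1 <= i <= n.+1)%N -> nset N = nset (radical (A_ i)) ->
  discriminates (induced Phi N (A_ i)).
Proof.
move=> le_i eqN K /finite_seqP[s ->].
have [//|phi Pphi [_ inj]] := radical_separate_quot s (s := [::]) le_i eqN.
have phiN : phi @` N = A_ i by rewrite eqN radical_image.
exists (induced_hom phiN); first by exists phi => //; exists phiN.
by move=> u v /set_mem us /set_mem vs; apply: inj.
Qed.

End Discriminated.

Theorem lemma6p1 (n : nat) (G : groupType) (P : {pred G}) (A : subGroupType P)
    (A_ : nat -> nsubgroup A) (Phi : set {ghom G -> A}) :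
  n_rigid n A ->
  principal_series n A_ ->
  (forall phi, Phi phi -> A_epimorphism phi) ->
  A_discriminates Phi ->
  [/\ n_rigid n G,
      (forall G_ : nat -> nsubgroup G, principal_series n G_ ->
         forall phi i, Phi phi -> (1 <= i <= n.+1)%N ->
           phi @` G_ i = A_ i) &
      (forall G_ : nat -> nsubgroup G, principal_series n G_ ->
         forall i, (1 <= i <= n.+1)%N ->
           discriminates (induced Phi (G_ i) (A_ i)))].
Proof.
move=> [_ solA] serA _ [discPhi idPhi].
pose iota : {ghom A -> G} := \val.
have Phi_id phi : Phi phi -> cancel iota phi by move/idPhi.
have serR := radical_principal_series serA Phi_id discPhi.
split=> [|G_ serG phi i Pphi le_i | G_ serG i le_i].
- split; first by exists n, (fun i => radical Phi (A_ i)).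
  exact: (radical_solvability_class serA Phi_id discPhi).
(* By uniqueness the given series consists of the radicals. *)
- rewrite (principal_series_unique serG serR le_i).
  exact: (radical_image Phi_id).
apply: (induced_discriminates serA Phi_id discPhi le_i).
exact: (principal_series_unique serG serR le_i).
Qed.
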